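(* Let $d\in\{1,2,3\}$, $\Omega=(0,1)^d$, $V_0=H^1_0(\Omega)$, $f\in L^2(\Omega)$, let $A_\epsilon\in L^\infty(\Omega,\mathbb{M}^{d\times d}_{\mathrm{sym}})$ and let $A_0$ be a $d\times d$ matrix function on $\Omega$ such that, for all $\zeta\in\mathbb{R}^d$ and $x\in\Omega$, $$\lambda^\epsilon_\ominus|\zeta|^2\le A_\epsilon(x)\zeta\cdot\zeta\le\lambda^\epsilon_\oplus|\zeta|^2,\qquad \lambda^0_\ominus|\zeta|^2\le A_0\zeta\cdot\zeta\le\lambda^0_\oplus|\zeta|^2$$ with positive constants. Let $\rho>0$, let $v\in V_0$, and let $u\in V_0$ be the solution of $$a_0(u,w)=a_0(v,w)-\rho\int_\Omega(A_\epsilon\nabla v\cdot\nabla w-fw)\,dx\qquad\forall w\in V_0 .$$ Let $\widetilde u\in V_0$ be an approximation of $u$. For $y\in H(\Omega,\mathrm{div})$ put $\eta=\widetilde u-v$, $\tau=y-\rho A_\epsilon\nabla v$, and $$\mathcal{M}_\oplus(\widetilde u,v,y)=\left(\int_\Omega\big(A_0\nabla\eta\cdot\nabla\eta+A_0^{-1}\tau\cdot\tau-2\nabla\eta\cdot\tau\big)dx\right)^{1/2}+\frac{C_F}{\lambda^0_\ominus}\,\|\mathrm{div}\,y+\rho f\| .$$ Then for every $y\in H(\Omega,\mathrm{div})$ $$\|u-\widetilde u\|_0\le\mathcal{M}_\oplus(\widetilde u,v,y),$$ and $$\inf_{y\in H(\Omega,\mathrm{div})}\mathcal{M}_\oplus(\widetilde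 u,v,y)=\|u-\widetilde u\|_0 ,$$ so that the estimate has no gap; indeed, for $y=A_0\nabla(u-v)+\rho A_\epsilon\nabla v$ one has $\tau=A_0\nabla(u-v)$, $\mathrm{div}\,y+\rho f=0$, and the first term of the majorant is equal to $\|u-\widetilde u\|_0$.
   Context: $\mathbb{M}^{d\times d}_{\mathrm{sym}}$ denotes the set of real symmetric $d\times d$ matrices. Notation: $a_0(u,w)=\int_\Omega A_0\nabla u\cdot\nabla w\,dx$; $\|w\|_0=a_0(w,w)^{1/2}$; $\|\cdot\|$ without subscript is the $L^2(\Omega)$ norm; $H(\Omega,\mathrm{div})$ is the space of vector fields in $L^2(\Omega,\mathbb{R}^d)$ with divergence in $L^2(\Omega)$; $C_F$ is the Friedrichs constant of $\Omega$, i.e. $\|w\|\le C_F\|\nabla w\|$ for all $w\in H^1_0(\Omega)$.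
   Formalization: A_0 is taken symmetric and measurable. The weight C_F/λ⁰_⊖ is asserted only for λ⁰_⊖ ≤ 1 (it is false in general above 1, e.g. d=1, A_0=4, f=sin πx, v=ũ=y=0); for every λ⁰_⊖ > 0 the claims are proved with C_F/√λ⁰_⊖ instead. *)

(* Defs.v *)
From HB Require Import structures.
From mathcomp Require Import all_boot all_order all_algebra.
From mathcomp Require Import all_classical all_reals all_analysis.

Set Implicit Arguments.
Unset Strict Implicit.
Unset Printing Implicit Defensive.

Import Order.TTheory GRing.Theory Num.Theory.
Import numFieldNormedType.Exports.

Local Open Scope classical_set_scope.
Local Open Scope ring_scope.

(* Points of R^n, and vectors, are column vectors 'cV[R]_n. *)

Definition coord (R : realType) (n : nat) (i : 'I_n) (x : 'cV[R]_n) :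
  measurableTypeR R := x i ord0.

Definition cV_display : measure_display. Proof. exact. Qed.

(* The product sigma-algebra on R^n, i.e. the Borel sigma-algebra. *)
Section measurable_cV.
Variables (R : realType) (n : nat).

Let cV_set0 : g_sigma_preimage (@coord R n) set0.
Proof. exact: sigma_algebra0. Qed.

Let cV_setC A : g_sigma_preimage (@coord R n) A ->
  g_sigma_preimage (@coord R n) (~` A).
Proof. exact: sigma_algebraC. Qed.

Let cV_bigcup (F : _^nat) : (forall i, g_sigma_preimage (@coord R n) (F i)) ->
  g_sigma_preimage (@coord R n) (\bigcup_i (F i)).
Proof. exact: sigma_algebra_bigcup. Qed.

HB.instance Definition _ := @isMeasurable.Build cV_display
  'cV[R]_n (g_sigma_preimage (@coord R n)) cV_set0 cV_setC cV_bigcup.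

End measurable_cV.

Lemma measurable_coord (R : realType) (n : nat) (i : 'I_n) :
  measurable_fun [set: 'cV[R]_n] (coord i).
Proof.
move=> _ Y mY; rewrite setTI; apply: sub_sigma_algebra => /=.
rewrite -bigcup_seq/=; exists i => /=; first by rewrite mem_index_enum.
by exists Y => //; rewrite setTI.
Qed.

Lemma measurable_fun_coordP d (T : measurableType d) (R : realType) (n : nat)
    (f : T -> 'cV[R]_n) :
  (forall i, measurable_fun [set: T] (coord i \o f)) ->
  measurable_fun [set: T] f.
Proof.
move=> mf _ A /= mA; rewrite setTI.
pose G : set (set 'cV[R]_n) := [set B | d.-measurable (f @^-1` B)].
suff : g_sigma_preimage (@coord R n) `<=` G by move=> /(_ _ mA).
apply: smallest_sub => [|B].
  split; rewrite /G /=.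
  - by rewrite preimage_set0.
  - by move=> B mB; rewrite setTD -preimage_setC; exact: measurableC.
  - by move=> F mF; rewrite preimage_bigcup; exact: bigcupT_measurable.
rewrite -bigcup_seq => -[i _ [C mC <-]]; rewrite /G /=.
by rewrite setTI -comp_preimage -[X in measurable X]setTI; exact: mf.
Qed.

Definition cV_cons (R : realType) (n : nat)
    (p : measurableTypeR R * 'cV[R]_n) : 'cV[R]_n.+1 :=
  col_mx (p.1%:M : 'cV[R]_1) p.2.

Lemma coord_cons0 (R : realType) (n : nat) (p : measurableTypeR R * 'cV[R]_n) :
  coord ord0 (cV_cons p) = p.1.
Proof.
rewrite /coord /cV_cons.
have -> : ord0 = lshift n (ord0 : 'I_1) :> 'I_n.+1 by exact: ord_inj.
by rewrite [LHS]col_mxEu mxE.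
Qed.

Lemma coord_consS (R : realType) (n : nat) (i : 'I_n)
    (p : measurableTypeR R * 'cV[R]_n) :
  coord (lift ord0 i) (cV_cons p) = coord i p.2.
Proof.
rewrite /coord /cV_cons.
have -> : lift ord0 i = rshift 1 i by exact: ord_inj.
exact: col_mxEd.
Qed.

Lemma measurable_cV_cons (R : realType) (n : nat) :
  measurable_fun [set: measurableTypeR R * 'cV[R]_n] (@cV_cons R n).
Proof.
apply: measurable_fun_coordP => i; case: (unliftP ord0 i) => [j ->|->].
  rewrite (_ : _ \o _ = coord j \o snd).
    by apply: measurableT_comp => //; exact: measurable_coord.
  by apply/funext => p; exact: coord_consS.
rewrite (_ : _ \o _ = fst) //.
by apply/funext => p; exact: coord_cons0.
Qed.

Definition cV_uncons (R : realType) (n : nat) (x : 'cV[R]_n.+1) :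
    measurableTypeR R * 'cV[R]_n :=
  (coord ord0 x, dsubmx (x : 'cV[R]_(1 + n))).

Lemma cV_consK (R : realType) (n : nat) :
  cancel (@cV_cons R n) (@cV_uncons R n).
Proof.
by case=> a x; rewrite /cV_uncons coord_cons0 /cV_cons /= col_mxKd.
Qed.

Lemma measurable_cV_uncons (R : realType) (n : nat) :
  measurable_fun [set: 'cV[R]_n.+1] (@cV_uncons R n).
Proof.
apply/measurable_fun_pairP; split; first exact: measurable_coord.
apply: measurable_fun_coordP => i.
rewrite (_ : _ \o _ = coord (rshift 1 i : 'I_n.+1)); last first.
  by apply/funext => x /=; rewrite /coord mxE.
exact: measurable_coord.
Qed.

Section lebesgue_step.
Variables (R : realType) (n : nat).
Variable m : {sigma_finite_measure set 'cV[R]_n -> \bar R}.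

Definition lebesgue_step : set 'cV[R]_n.+1 -> \bar R :=
  pushforward (lebesgue_measure \x m)%E (@cV_cons R n).

HB.instance Definition _ := Measure.copy lebesgue_step
  (measure_function_pushforward__canonical__measure_function_Measure
    (lebesgue_measure \x m)%E (@measurable_cV_cons R n)).

Let lebesgue_step_sigma_finite : sigma_finite [set: 'cV[R]_n.+1] lebesgue_step.
Proof.
have /sigma_finiteP[F [TF ndF Foo]] :=
  sigma_finiteT (@lebesgue_measure R : {sigma_finite_measure set _ -> \bar R}).
have /sigma_finiteP[G [TG ndG Goo]] := sigma_finiteT m.
exists (fun k => @cV_uncons R n @^-1` (F k `*` G k)).
  rewrite -preimage_bigcup -(preimage_setT (@cV_uncons R n)); congr preimage.
  rewrite -setXTT TF TG predeqE => -[x y]; split.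
    move=> [/= [i _ Fx] [k _ Gy]]; exists (maxn i k) => //; split.
      by move: x Fx; exact/subsetPset/ndF/leq_maxl.
    by move: y Gy; exact/subsetPset/ndG/leq_maxr.
  by move=> [i _ []/= ? ?]; split; exists i.
move=> k; have [mFk Fk] := Foo k; have [mGk Gk] := Goo k; split.
  rewrite -[X in measurable X]setTI; apply: measurable_cV_uncons => //.
  exact: measurableX.
rewrite /lebesgue_step /pushforward -comp_preimage.
rewrite (_ : _ \o _ = id); last by rewrite funeqE => p; exact: cV_consK.
rewrite preimage_id product_measure1E// lte_mul_pinfty// ge0_fin_numE//.
Qed.

HB.instance Definition _ := Measure_isSigmaFinite.Build _ _ _ lebesgue_step
  lebesgue_step_sigma_finite.

End lebesgue_step.

(* Lebesgue measure on R^n, as the n-fold product of the one on R. *)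
Fixpoint lebesgue_cV (R : realType) (n : nat) :
    {sigma_finite_measure set 'cV[R]_n -> \bar R} :=
  match n with
  | 0 => dirac (0 : 'cV[R]_0)
  | n'.+1 => lebesgue_step (lebesgue_cV R n')
  end.

Lemma lebesgue_cV_box (R : realType) (n : nat)
    (A : 'I_n -> set (measurableTypeR R)) :
  (forall i, measurable (A i)) ->
  lebesgue_cV R n [set x | forall i, A i (coord i x)] =
  (\prod_(i < n) lebesgue_measure (A i))%E.
Proof.
elim: n A => [|n IH] A mA.
  by rewrite big_ord0 /= diracE mem_set//; case.
rewrite big_ord_recl -IH// -product_measure1E //=; last first.
  rewrite (_ : [set _ | _] = \bigcap_(i in [set: 'I_n])
    (coord i @^-1` A (lift ord0 i))); last first.
    by apply/seteqP; split=> [x /= Ax i _|x /= Ax i]; [exact: Ax|exact: Ax i I].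
  apply: fin_bigcap_measurable => // i _.
  by rewrite -[X in measurable X]setTI; exact: measurable_coord.
rewrite /lebesgue_step /pushforward; congr product_measure1.
apply/seteqP; split=> -[a x] /=.
  move=> Ax; split=> [|i]; last have := Ax (lift ord0 i).
    by have := Ax ord0; rewrite coord_cons0.
  by rewrite coord_consS.
move=> [Aa Ax] i; case: (unliftP ord0 i) => [j ->|->].
  by rewrite coord_consS; exact: Ax.
by rewrite coord_cons0.
Qed.

Section cube.
Variables (R : realType) (d : nat).

Definition cube : set 'cV[R]_d := [set x | forall i, 0 < x i ord0 < 1].

Lemma measurable_cube : measurable cube.
Proof.
rewrite (_ : cube = \bigcap_(i in [set: 'I_d])
    (coord i @^-1` `]0, 1[%classic)); last first.
  apply/seteqP; split=> [x /= cx i _|x /= cx i].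
    by rewrite /= in_itv /=; exact: cx.
  by have := cx i I; rewrite /= in_itv.
apply: fin_bigcap_measurable => // i _.
by rewrite -[X in measurable X]setTI; exact: measurable_coord.
Qed.

(* Functions on the cube are represented by functions on R^d, considered
   modulo equality almost everywhere for this measure. *)
Definition cube_measure : set 'cV[R]_d -> \bar R :=
  mrestr (lebesgue_cV R d) measurable_cube.

HB.instance Definition _ := Measure.on cube_measure.

End cube.

Definition dot (R : realType) (d : nat) (a b : 'cV[R]_d) : R :=
  \sum_(i < d) a i ord0 * b i ord0.

Definition euclid (R : realType) (d : nat) (a : 'cV[R]_d) : R :=
  Num.sqrt (dot a a).

Section spaces.
Variables (R : realType) (d : nat).
Local Notation mu := (@cube_measure R d).

Definition L2 (w : 'cV[R]_d -> R) : Prop := w \in Lfun mu 2%:E.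

Definition L2vec (F : 'cV[R]_d -> 'cV[R]_d) : Prop :=
  forall i, L2 (fun x => F x i ord0).

Definition eL2norm (w : 'cV[R]_d -> R) : \bar R := 'N[mu]_2%:E[EFin \o w]%E.

Definition L2norm (w : 'cV[R]_d -> R) : R := fine (eL2norm w).

Definition partial (i : 'I_d) (phi : 'cV[R]_d -> R) : 'cV[R]_d -> R :=
  fun x => 'D_(delta_mx i ord0) phi x.

Definition gradient (phi : 'cV[R]_d -> R) (x : 'cV[R]_d) : 'cV[R]_d :=
  \col_i partial i phi x.

Definition smooth (phi : 'cV[R]_d -> R) : Prop :=
  forall (s : seq 'I_d) x, differentiable (foldr partial phi s) x.

(* C_c^oo of the cube *)
Definition test_function (phi : 'cV[R]_d -> R) : Prop :=
  [/\ smooth phi, compact (closure [set x | phi x != 0]) &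
      closure [set x | phi x != 0] `<=` @cube R d].

(* [H10 w Dw] : w is in H^1_0, the closure of C_c^oo for the H^1 norm, and Dw
   is its gradient, that is, the limit of the gradients of the approximating
   functions (it is the weak gradient of w, unique almost everywhere). *)
Definition H10 (w : 'cV[R]_d -> R) (Dw : 'cV[R]_d -> 'cV[R]_d) : Prop :=
  [/\ L2 w, L2vec Dw & exists phi : nat -> 'cV[R]_d -> R,
    [/\ forall n, test_function (phi n),
        eL2norm (phi n \- w) @[n --> \oo] --> 0%E &
        eL2norm (fun x => euclid (gradient (phi n) x - Dw x))
          @[n --> \oo] --> 0%E]].

(* [Hdiv y divy] : y is in H(div) and divy is its weak divergence. *)
Definition Hdiv (y : 'cV[R]_d -> 'cV[R]_d) (divy : 'cV[R]_d -> R) : Prop :=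
  [/\ L2vec y, L2 divy & forall phi, test_function phi ->
    \int[mu]_x dot (y x) (gradient phi x) = - \int[mu]_x (divy x * phi x)].

(* The bilinear form a(u, w) in terms of F = grad u and G = grad w. *)
Definition energy (A : 'cV[R]_d -> 'M[R]_d) (F G : 'cV[R]_d -> 'cV[R]_d) : R :=
  \int[mu]_x dot (A x *m F x) (G x).

Definition energy_norm (A : 'cV[R]_d -> 'M[R]_d) (F : 'cV[R]_d -> 'cV[R]_d) :
  R := Num.sqrt (energy A F F).

Definition elliptic (A : 'cV[R]_d -> 'M[R]_d) (lmin lmax : R) : Prop :=
  forall x, @cube R d x -> forall z : 'cV[R]_d,
    lmin * dot z z <= dot (A x *m z) z <= lmax * dot z z.

Definition symmetric_on_cube (A : 'cV[R]_d -> 'M[R]_d) : Prop :=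
  forall x, @cube R d x -> (A x)^T = A x.

Definition friedrichs (CF : R) : Prop :=
  0 <= CF /\ forall w Dw, H10 w Dw -> L2norm w <= CF * L2norm (@euclid R d \o Dw).

(* The argument [Deta] is the gradient of eta. *)
Definition majorant_flux (A0 : 'cV[R]_d -> 'M[R]_d)
    (Deta tau : 'cV[R]_d -> 'cV[R]_d) : R :=
  Num.sqrt (\int[mu]_x (dot (A0 x *m Deta x) (Deta x)
    + dot (invmx (A0 x) *m tau x) (tau x) - 2 * dot (Deta x) (tau x))).

(* The weight of the equation residual is CF / kappa: since
   lam * |grad w|^2 <= a0(w, w), bounding the residual functional in the energy
   norm gives kappa = sqrt lam; the larger weight CF / lam is then admissible
   when lam <= 1, but not in general when lam > 1. *)
Definition majorant (A0 Aeps : 'cV[R]_d -> 'M[R]_d) (rho : R)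
    (f : 'cV[R]_d -> R) (CF kappa : R) (Dut Dv : 'cV[R]_d -> 'cV[R]_d)
    (y : 'cV[R]_d -> 'cV[R]_d) (divy : 'cV[R]_d -> R) : R :=
  majorant_flux A0 (fun x => Dut x - Dv x)
                   (fun x => y x - rho *: (Aeps x *m Dv x))
  + CF / kappa * L2norm (fun x => divy x + rho * f x).

End spaces.

(* Main.v *)
(* Write W = D(u - ut) and P = A0^-1 tau - D(ut - v).  Adding the weak
   divergence identity, which extends by density from test functions to H^1_0,
   to the equation of u gives
     a0(u - ut, w) = \int A0 P . Dw + \int (div y + rho f) w   for w in H^1_0.
   The flux term of the majorant is the energy norm of P (complete the square),
   so taking w = u - ut, the Cauchy-Schwarz inequality and the Friedrichs
   inequality, combined with lam |W|^2 <= A0 W . W, bound the energy of the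
   error.  The choice y = A0 D(u - v) + rho Aeps Dv annihilates the residual and
   makes P = W, so the infimum is attained. *)
Require Import Defs.
From HB Require Import structures.
From mathcomp Require Import all_boot all_order all_algebra.
From mathcomp Require Import all_classical all_reals all_analysis.
From mathcomp Require Import measurable_realfun ess_sup_inf.
From mathcomp Require Import ring lra.

Set Implicit Arguments.
Unset Strict Implicit.
Unset Printing Implicit Defensive.

Import Order.TTheory GRing.Theory Num.Theory.
Import numFieldNormedType.Exports.

Local Open Scope classical_set_scope.
Local Open Scope ring_scope.

(** * Square-integrable functions and almost everywhere comparison of integrals *)

Section square_integrable.
Context d (T : measurableType d) (R : realType).
Variable mu : {measure set T -> \bar R}.
Implicit Types f g h : T -> R.

Lemma measurable_Lfun p f : f \in Lfun mu p -> measurable_fun [set: T] f.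
Proof. by rewrite inE => /andP[/[!inE]]. Qed.

Lemma Lnorm2E f :
  ('N[mu]_2%:E[EFin \o f] = (\int[mu]_x (f x ^+ 2)%:E) `^ 2^-1)%E.
Proof.
rewrite unlock /Lnorm; congr (_ `^ _)%E; apply: eq_integral => x _ /=.
by rewrite -(ger0_norm (sqr_ge0 (f x))) normrX -powR_mulrn.
Qed.

Lemma Lfun2P f : f \in Lfun mu 2%:E <->
  measurable_fun [set: T] f /\
  mu.-integrable [set: T] (EFin \o (fun x => f x ^+ 2)).
Proof.
split=> [Lf|[mf /integrableP[_ foo]]].
  by split; [exact: measurable_Lfun Lf|exact: Lfun2_integrable_sqr].
rewrite inE; apply/andP; split; rewrite inE//= /finite_norm Lnorm2E.
apply: poweR_lty; apply: le_lt_trans foo.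
rewrite le_eqVlt; apply/orP; left; apply/eqP.
by apply: eq_integral => x _ /=; rewrite ger0_norm// sqr_ge0.
Qed.

Lemma Lnorm2_sqrt f : f \in Lfun mu 2%:E ->
  'N[mu]_2%:E[EFin \o f]%E = (Num.sqrt (\int[mu]_x (f x ^+ 2)))%:E.
Proof.
move=> /Lfun2P[_ if2]; rewrite Lnorm2E -powR12_sqrt; last first.
  by apply: Rintegral_ge0 => x _; exact: sqr_ge0.
rewrite -poweR_EFin /Rintegral fineK//.
exact: integrable_fin_num.
Qed.

Lemma ae_le_Rintegral f g :
  mu.-integrable [set: T] (EFin \o f) -> mu.-integrable [set: T] (EFin \o g) ->
  (\forall x \ae mu, f x <= g x) -> \int[mu]_x f x <= \int[mu]_x g x.
Proof.
move=> if_ ig fg; rewrite -subr_ge0 -RintegralB//.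
have igf : mu.-integrable [set: T] (EFin \o (fun x => g x - f x)).
  exact: (integrableB measurableT ig if_).
have [/measurable_EFinP mgf _] := integrableP _ _ _ igf.
(* The positive part agrees with [g - f] almost everywhere and is nonnegative at every point, as
   [Rintegral_ge0] requires. *)
rewrite [leRHS](_ : _ = \int[mu]_x Num.max 0 (g x - f x)).
  by apply: Rintegral_ge0 => x _; rewrite le_max lexx.
congr fine; apply: ae_eq_integral => //.
- exact/measurable_EFinP.
- by apply/measurable_EFinP; exact: measurable_maxr.
- by apply: filterS fg => x fgx _; rewrite max_r// subr_ge0.
Qed.

Lemma ae_eq_Rintegral f g :
  measurable_fun [set: T] f -> measurable_fun [set: T] g ->
  (\forall x \ae mu, f x = g x) -> \int[mu]_x f x = \int[mu]_x g x.
Proof.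
move=> mf mg fg; congr fine; apply: ae_eq_integral => //; [exact/measurable_EFinP..|].
by apply: filterS fg => x -> _.
Qed.

Lemma ae_le_integrable f g : measurable_fun [set: T] f ->
  mu.-integrable [set: T] (EFin \o g) -> (\forall x \ae mu, `|f x| <= g x) ->
  mu.-integrable [set: T] (EFin \o f).
Proof.
move=> mf /integrableP[mg goo] fg; apply/integrableP; split.
  exact/measurable_EFinP.
apply: le_lt_trans goo; apply: ae_ge0_le_integral => //.
- by apply: measurableT_comp => //; exact/measurable_EFinP.
- exact: measurableT_comp.
- apply: filterS fg => x fgx _ /=; rewrite lee_fin.
  by rewrite (le_trans fgx)// ler_norm.
Qed.

Lemma ae_le_Lfun2 f g : measurable_fun [set: T] f -> g \in Lfun mu 2%:E ->
  (\forall x \ae mu, `|f x| <= `|g x|) -> f \in Lfun mu 2%:E.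
Proof.
move=> mf /Lfun2P[mg ig] fg; apply/Lfun2P; split => //.
apply: ae_le_integrable ig _; first exact: measurable_funX.
apply: filterS fg => x fgx; rewrite normrX -[leRHS]ger0_norm ?sqr_ge0// normrX.
by rewrite lerXn2r ?nnegrE.
Qed.

Lemma Lfun2D f g : f \in Lfun mu 2%:E -> g \in Lfun mu 2%:E ->
  (fun x => f x + g x) \in Lfun mu 2%:E.
Proof.
have p1 : (1 <= (2%:E : \bar R))%E by rewrite lee_fin ler1n.
by move=> Lf Lg; have [_] := Lfun_addr_closed mu p1; apply.
Qed.

Lemma Lfun2Z (c : R) f : f \in Lfun mu 2%:E ->
  (fun x => c * f x) \in Lfun mu 2%:E.
Proof.
move=> Lf; rewrite (_ : (fun _ => _) = c \o* f); last first.
  by apply/funext => x /=; rewrite mulrC.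
by apply: Lfun_scale => //; rewrite ler1n.
Qed.

Lemma Lfun2B f g : f \in Lfun mu 2%:E -> g \in Lfun mu 2%:E ->
  (fun x => f x - g x) \in Lfun mu 2%:E.
Proof.
move=> Lf Lg; rewrite (_ : (fun _ => _) = (fun x => f x + -1 * g x)).
  exact: (Lfun2D Lf (Lfun2Z (-1) Lg)).
by apply/funext => x; rewrite mulN1r.
Qed.

Lemma Lfun2_sum (I : Type) (s : seq I) (F : I -> T -> R) :
  (forall i, F i \in Lfun mu 2%:E) ->
  (fun x => \sum_(i <- s) F i x) \in Lfun mu 2%:E.
Proof.
move=> LF; elim: s => [|i s IHs].
  rewrite (_ : (fun _ => _) = cst 0); last by apply/funext => x; rewrite big_nil.
  apply/Lfun2P; split; first exact: measurable_cst.
  rewrite (_ : _ \o _ = cst 0%E); first exact: integrable0.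
  by apply/funext => x /=; rewrite expr0n.
rewrite (_ : (fun _ => _) = fun x => F i x + \sum_(j <- s) F j x).
  exact: Lfun2D.
by apply/funext => x; rewrite big_cons.
Qed.

Lemma Lfun2M_integrable f g : f \in Lfun mu 2%:E -> g \in Lfun mu 2%:E ->
  mu.-integrable [set: T] (EFin \o (fun x => f x * g x)).
Proof. by move=> Lf Lg; apply/Lfun1_integrable; exact: Lfun2_mul_Lfun1. Qed.

(** The working form of membership in L^oo: a bound off a null set. [Aeps] satisfies it through its
    essential supremum, [A0] and its inverse through ellipticity on the cube. *)
Definition ae_bounded f :=
  measurable_fun [set: T] f /\ exists M, \forall x \ae mu, `|f x| <= M.

Lemma Lfun2_ae_boundedM f g : ae_bounded f -> g \in Lfun mu 2%:E ->
  (fun x => f x * g x) \in Lfun mu 2%:E.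
Proof.
move=> [mf [M fM]] Lg; apply: (ae_le_Lfun2 _ (Lfun2Z M Lg)).
  by apply: measurable_funM => //; exact: measurable_Lfun Lg.
apply: filterS fM => x fM; rewrite !normrM ler_wpM2r//.
by rewrite (le_trans fM)// ler_norm.
Qed.

End square_integrable.

(** * Cauchy-Schwarz from nonnegative quadratic polynomials *)

Lemma discriminant_le (R : realFieldType) (a b c : R) :
  0 <= c -> (forall t, 0 <= a + t * (2 * b) + t ^+ 2 * c) -> b ^+ 2 <= a * c.
Proof.
rewrite le_eqVlt => /predU1P[<- abt|c0 abt]; last first.
  (* The minimum of the polynomial is attained at [- b / c]. *)
  have := abt (- b / c); rewrite (_ : _ + _ = (a * c - b ^+ 2) / c).
    by rewrite pmulr_lge0 ?invr_gt0// subr_ge0.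
  by field; rewrite gt_eqF.
have [->|b0] := eqVneq b 0; first by rewrite expr0n mulr0.
(* With [c = 0] the polynomial is affine, and at this point it takes the value -1, a
   contradiction. *)
have := abt (- (a + 1) / (2 * b)).
rewrite mulr0 addr0 divfK ?mulf_neq0 ?pnatr_eq0//; lra.
Qed.

Section quadratic_cauchy_schwarz.
Context d (T : measurableType d) (R : realType).
Variable mu : {measure set T -> \bar R}.

(** Integrating the pointwise form for fixed [t] and [s] gives a nonnegative form in [(t, s)], and
    its discriminant is the inequality. Keeping three separate integrands lets one proof serve
    products of functions, dot products of fields and the energy form. *)
Lemma Rintegral_cauchy_schwarz (f g h : T -> R) :
  mu.-integrable [set: T] (EFin \o f) -> mu.-integrable [set: T] (EFin \o g) ->
  mu.-integrable [set: T] (EFin \o h) ->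
  (\forall x \ae mu, forall t s, 0 <= t ^+ 2 * f x + 2 * t * s * g x + s ^+ 2 * h x) ->
  `|\int[mu]_x g x| <=
  Num.sqrt (\int[mu]_x f x) * Num.sqrt (\int[mu]_x h x).
Proof.
move=> if_ ig ih fgh.
have ge0 t s :
    0 <= t ^+ 2 * (\int[mu]_x f x) + 2 * t * s * (\int[mu]_x g x) +
         s ^+ 2 * (\int[mu]_x h x).
  have iZ (c : R) u : mu.-integrable [set: T] (EFin \o u) ->
      mu.-integrable [set: T] (EFin \o (fun x => c * u x)).
    by move=> iu; exact: (integrableZl _ c iu).
  have i1 := iZ (t ^+ 2) _ if_; have i2 := iZ (2 * t * s) _ ig.
  have i3 := iZ (s ^+ 2) _ ih; have i12 := integrableD measurableT i1 i2.
  rewrite -!RintegralZl// -(RintegralD measurableT i1 i2).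
  rewrite -(RintegralD measurableT i12 i3).
  rewrite [leLHS](_ : 0 = \int[mu]_x (cst 0 x : R)); last first.
    by rewrite Rintegral_cst// mul0r.
  apply: ae_le_Rintegral.
  - exact: integrable0.
  - exact: (integrableD measurableT i12 i3).
  - by apply: filterS fgh => x; apply.
have f0 : 0 <= \int[mu]_x f x by have := ge0 1 0; lra.
have h0 : 0 <= \int[mu]_x h x by have := ge0 0 1; lra.
rewrite -sqrtrM// -sqrtr_sqr ler_wsqrtr//; apply: discriminant_le => // t.
by have := ge0 1 t; rewrite expr1n mul1r mulr1 mulrA (mulrC 2).
Qed.

End quadratic_cauchy_schwarz.

(** * The dot product, and matrices with two-sided ellipticity bounds *)

Section dot_product.
Variables (R : realType) (n : nat).
Implicit Types (a b c : 'cV[R]_n) (A : 'M[R]_n).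

Lemma dotE a b : dot a b = (a^T *m b) ord0 ord0.
Proof. by rewrite mxE; apply: eq_bigr => i _; rewrite mxE. Qed.

Lemma dotC a b : dot a b = dot b a.
Proof. by apply: eq_bigr => i _; rewrite mulrC. Qed.

Lemma dotDl a b c : dot (a + b) c = dot a c + dot b c.
Proof. by rewrite !dotE linearD mulmxDl mxE. Qed.

Lemma dotNl a c : dot (- a) c = - dot a c.
Proof. by rewrite !dotE linearN mulNmx mxE. Qed.

Lemma dotBl a b c : dot (a - b) c = dot a c - dot b c.
Proof. by rewrite dotDl dotNl. Qed.

Lemma dotZl (k : R) a c : dot (k *: a) c = k * dot a c.
Proof. by rewrite !dotE linearZ -scalemxAl mxE. Qed.

Lemma dotDr a b c : dot a (b + c) = dot a b + dot a c.
Proof. by rewrite dotC dotDl !(dotC a). Qed.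

Lemma dotNr a c : dot a (- c) = - dot a c.
Proof. by rewrite dotC dotNl dotC. Qed.

Lemma dotBr a b c : dot a (b - c) = dot a b - dot a c.
Proof. by rewrite dotDr dotNr. Qed.

Lemma dotZr (k : R) a c : dot a (k *: c) = k * dot a c.
Proof. by rewrite dotC dotZl dotC. Qed.

Lemma dot_mulmx A a b : dot (A *m a) b = dot a (A^T *m b).
Proof. by rewrite !dotE trmx_mul mulmxA. Qed.

Lemma dot_ge0 a : 0 <= dot a a.
Proof. by apply: sumr_ge0 => i _; rewrite -expr2 sqr_ge0. Qed.

Lemma dot_eq0 a : dot a a = 0 -> a = 0.
Proof.
move=> a0; apply/matrixP => i j; rewrite ord1 mxE; apply/eqP.
rewrite -sqrf_eq0 expr2; move/eqP: a0; rewrite psumr_eq0 => [|k _].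
  by move=> /allP/(_ i); rewrite mem_index_enum => /(_ isT).
by rewrite -expr2 sqr_ge0.
Qed.

Lemma euclid_ge0 a : 0 <= euclid a. Proof. exact: sqrtr_ge0. Qed.

Lemma sqr_euclid a : euclid a ^+ 2 = dot a a.
Proof. by rewrite sqr_sqrtr// dot_ge0. Qed.

Lemma normr_dot_le a b : `|dot a b| <= euclid a * euclid b.
Proof.
rewrite -sqrtrM ?dot_ge0// -sqrtr_sqr ler_wsqrtr//.
apply: discriminant_le => [|t]; first exact: dot_ge0.
have := dot_ge0 (a + t *: b).
rewrite dotDl !dotDr !dotZl !dotZr (dotC b a) => /le_trans; apply.
by rewrite le_eqVlt; apply/orP; left; apply/eqP; ring.
Qed.

Lemma euclidB_le a b : euclid (a - b) <= euclid a + euclid b.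
Proof.
rewrite -(ler_pXn2r (n := 2))// ?nnegrE ?addr_ge0 ?euclid_ge0//.
rewrite sqrrD !sqr_euclid dotBl !dotBr (dotC b a).
have := normr_dot_le a b; rewrite ler_norml => /andP[+ _]; lra.
Qed.

Lemma dot_mulmx_delta A i j :
  dot (A *m delta_mx i ord0) (delta_mx j ord0) = A j i.
Proof.
rewrite -colE dotC /dot (bigD1 j)//= big1 ?addr0 => [|k kj].
  by rewrite !mxE !eqxx mul1r.
by rewrite !mxE (negPf kj) mul0r.
Qed.

(* Polarization along the coordinate axes. *)
Lemma normr_entry_le A (L : R) : A^T = A ->
  (forall z, 0 <= dot (A *m z) z <= L * dot z z) ->
  forall i j, `|A i j| <= L.
Proof.
move=> Asym AL i j; set ei := delta_mx i ord0 : 'cV[R]_n.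
set ej := delta_mx j ord0 : 'cV[R]_n.
(* Nonnegativity at [ei + ej] and [ei - ej] gives 2 |A i j| <= A i i + A j j, and both diagonal
   entries are at most [L]. *)
have := AL (ei + ej); have := AL (ei - ej).
rewrite !mulmxDr !mulmxN !(dotDl, dotDr, dotNl, dotNr) !dot_mulmx_delta.
have -> : A j i = A i j by rewrite -[in LHS]Asym mxE.
have dij k l : dot (delta_mx k ord0 : 'cV[R]_n) (delta_mx l ord0) = (k == l)%:R.
  by rewrite -[X in dot X]mul1mx dot_mulmx_delta mxE eq_sym.
rewrite !dij !eqxx eq_sym.
have := AL ei; have := AL ej; rewrite !dot_mulmx_delta !dij !eqxx !mulr1.
move=> /andP[? ?] /andP[? ?] /andP[? ?] /andP[? ?].
by rewrite ler_norml; apply/andP; split; lra.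
Qed.

Section coercive.
Variables (A : 'M[R]_n) (l L : R).
Hypotheses (l0 : 0 < l) (Asym : A^T = A).
Hypothesis AlL : forall z : 'cV[R]_n, l * dot z z <= dot (A *m z) z <= L * dot z z.

(** A row [k] with [k *m A = 0] satisfies A k^T = 0 by symmetry, so coercivity forces l |k|^2 <=
    0. *)
Lemma coercive_unitmx : A \in unitmx.
Proof.
rewrite -row_free_unit -kermx_eq0; apply/eqP/row_matrixP => i.
rewrite row0; set k := row i _.
have kA : k *m A = 0 by apply/sub_kermxP; exact: row_sub.
have : k^T = 0.
  apply: dot_eq0; apply/eqP; rewrite eq_le dot_ge0 andbT.
  have /andP[+ _] := AlL k^T.
  rewrite -Asym -trmx_mul kA [X in _ <= X -> _]big1 => [|j _]; last first.
    by rewrite !mxE mul0r.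
  by rewrite pmulr_rle0.
by move/(congr1 trmx); rewrite trmxK trmx0.
Qed.

(** Put y = A^-1 z, so that l |y|^2 <= z . y. Then 0 <= |z - l y|^2 = |z|^2 - 2 l z . y + l^2 |y|^2
    <= |z|^2 - l z . y. These bounds give the inverse entries of size at most 1/l. *)
Lemma coercive_invmx (z : 'cV[R]_n) :
  0 <= dot (invmx A *m z) z <= l^-1 * dot z z.
Proof.
set y := invmx A *m z.
have zE : z = A *m y by rewrite mulKVmx// coercive_unitmx.
have /andP[+ _] := AlL y; rewrite -zE => ly.
have ly0 : 0 <= l * dot y y by rewrite mulr_ge0 ?dot_ge0 ?ltW.
rewrite dotC (le_trans ly0 ly)/= mulrC ler_pdivlMr// mulrC.
have := dot_ge0 (z - l *: y).
rewrite dotBl !dotBr !dotZl !dotZr (dotC y z).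
have : l * (l * dot y y) <= l * dot z y by rewrite ler_wpM2l// ltW.
lra.
Qed.

End coercive.

End dot_product.

(** * Integrability and Cauchy-Schwarz inequalities on the cube *)

Section cube_measure_theory.
Variables (R : realType) (d : nat).
Local Notation mu := (@cube_measure R d).
Implicit Types (A : 'cV[R]_d -> 'M[R]_d) (F G : 'cV[R]_d -> 'cV[R]_d).

(** The measure lives on all of R^d but is restricted to the cube, so the complement of the cube is
    null. This turns pointwise hypotheses on the cube into almost everywhere ones. *)
Lemma cube_ae (P : 'cV[R]_d -> Prop) :
  (forall x, cube x -> P x) -> \forall x \ae mu, P x.
Proof.
move=> cP; exists (~` @cube R d); split.
- by apply: measurableC; exact: measurable_cube.
- by rewrite /= /cube_measure /mrestr setICl measure0.
- by move=> x /= nPx cx; exact/nPx/cP.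
Qed.

Lemma cube_measureT : mu [set: 'cV[R]_d] = 1%E.
Proof.
rewrite /cube_measure /mrestr setTI.
rewrite (_ : @cube R d = [set x | forall i, `]0, 1[%classic (Defs.coord i x)]).
  rewrite (@lebesgue_cV_box R d (fun=> `]0, 1[%classic)) => [|i]; last first.
    exact: measurable_itv.
  rewrite big1// => i _; rewrite lebesgue_measure_itv/= lte_fin ltr01.
  by rewrite -EFinD subr0.
by apply/seteqP; split=> x /= cx i; have := cx i; rewrite /= in_itv.
Qed.

Lemma Lfuny_ae_bounded (g : 'cV[R]_d -> R) : g \in Lfun mu +oo%E -> ae_bounded mu g.
Proof.
move=> Lg; split; first exact: measurable_Lfun Lg.
move: Lg; rewrite inE => /andP[_]; rewrite inE/= /finite_norm unlock /Lnorm.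
(* The norm of exponent +oo is the essential supremum only if the total mass is positive. *)
have mu0 : (0 < mu setT)%E by rewrite cube_measureT lte01.
rewrite ifT => [gy|]; last exact: mu0.
exists (fine (ess_sup mu (abse \o (EFin \o g)))).
have : ess_sup mu (abse \o (EFin \o g)) \is a fin_num.
  rewrite ge0_fin_numE//; apply: ess_sup_gee; first exact: mu0.
  by apply: nearW => x /=; rewrite lee_fin.
move=> fn; have := ess_sup_ge mu (abse \o (EFin \o g)).
by apply: filterS => x /=; rewrite -{1}(fineK fn) lee_fin.
Qed.

Lemma cube_bounded_ae_bounded (g : 'cV[R]_d -> R) (M : R) :
  measurable_fun [set: 'cV[R]_d] g -> (forall x, cube x -> `|g x| <= M) ->
  ae_bounded mu g.
Proof. by move=> mg gM; split=> //; exists M; exact: cube_ae. Qed.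

Lemma L2_cube_bounded (g : 'cV[R]_d -> R) (M : R) :
  measurable_fun [set: 'cV[R]_d] g -> (forall x, cube x -> `|g x| <= M) -> L2 g.
Proof.
move=> mg gM; apply/Lfun2P; split=> //.
apply: (@ae_le_integrable _ _ _ _ _ (cst (M ^+ 2))).
- exact: measurable_funX.
- apply/integrableP; split.
    exact/measurable_EFinP/measurable_cst.
  rewrite (eq_integral (cst `|M ^+ 2|%:E))//.
  by rewrite integral_cst//= cube_measureT mule1 ltry.
- apply: cube_ae => x cx; rewrite normrX lerXn2r ?nnegrE ?gM//.
  exact: le_trans (normr_ge0 _) (gM x cx).
Qed.

Lemma L2vecD F G : L2vec F -> L2vec G -> L2vec (fun x => F x + G x).
Proof.
move=> LF LG i; rewrite /L2 (_ : (fun _ => _) = fun x => F x i ord0 + G x i ord0).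
  exact: (Lfun2D (LF i) (LG i)).
by apply/funext => x; rewrite mxE.
Qed.

Lemma L2vecZ (k : R) F : L2vec F -> L2vec (fun x => k *: F x).
Proof.
move=> LF i; rewrite /L2 (_ : (fun _ => _) = fun x => k * F x i ord0).
  exact: (Lfun2Z k (LF i)).
by apply/funext => x; rewrite mxE.
Qed.

Lemma L2vecB F G : L2vec F -> L2vec G -> L2vec (fun x => F x - G x).
Proof.
move=> LF LG; have := L2vecD LF (L2vecZ (-1) LG).
by congr L2vec; apply/funext => x; rewrite scaleN1r.
Qed.

Lemma L2vec_mulmx A F : (forall i j, ae_bounded mu (fun x => A x i j)) ->
  L2vec F -> L2vec (fun x => A x *m F x).
Proof.
move=> bA LF i.
rewrite /L2 (_ : (fun _ => _) = fun x => \sum_j A x i j * F x j ord0).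
  apply: (Lfun2_sum _ (F := fun j x => A x i j * F x j ord0)) => j.
  exact: (Lfun2_ae_boundedM (bA i j) (LF j)).
by apply/funext => x; rewrite mxE.
Qed.

Lemma integrable_dot F G : L2vec F -> L2vec G ->
  mu.-integrable [set: 'cV[R]_d] (EFin \o (fun x => dot (F x) (G x))).
Proof.
move=> LF LG.
rewrite (_ : _ \o _ = fun x => \sum_i (F x i ord0 * G x i ord0)%:E)%E.
  by apply: integrable_sum => // i _; exact: (Lfun2M_integrable (LF i) (LG i)).
by apply/funext => x; rewrite /= sumEFin.
Qed.

Lemma measurable_dot F G : L2vec F -> L2vec G ->
  measurable_fun [set: 'cV[R]_d] (fun x => dot (F x) (G x)).
Proof. by move=> LF LG; have /integrableP[/measurable_EFinP] := integrable_dot LF LG. Qed.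

Lemma L2_euclid F : L2vec F -> L2 (@euclid R d \o F).
Proof.
move=> LF; apply/Lfun2P; split.
  apply: (measurableT_comp (continuous_measurable_fun (@sqrt_continuous R))).
  exact: measurable_dot.
rewrite (_ : _ \o _ = EFin \o (fun x => dot (F x) (F x))).
  exact: integrable_dot.
by apply/funext => x /=; rewrite sqr_euclid.
Qed.

Lemma L2norm_euclid F : L2vec F ->
  L2norm (@euclid R d \o F) = Num.sqrt (\int[mu]_x dot (F x) (F x)).
Proof.
move=> LF; rewrite /L2norm /eL2norm Lnorm2_sqrt; last exact: L2_euclid.
by congr Num.sqrt; apply: eq_Rintegral => x _ /=; rewrite sqr_euclid.
Qed.

Lemma L2_cauchy_schwarz (f g : 'cV[R]_d -> R) : L2 f -> L2 g ->
  `|\int[mu]_x (f x * g x)| <= L2norm f * L2norm g.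
Proof.
move=> Lf Lg; rewrite /L2norm /eL2norm !Lnorm2_sqrt//.
apply: Rintegral_cauchy_schwarz.
- exact: Lfun2_integrable_sqr.
- exact: Lfun2M_integrable.
- exact: Lfun2_integrable_sqr.
- apply: nearW => x t s; rewrite (_ : _ + _ = (t * f x + s * g x) ^+ 2).
    exact: sqr_ge0.
  by ring.
Qed.

Lemma dot_L2_cauchy_schwarz F G : L2vec F -> L2vec G ->
  `|\int[mu]_x dot (F x) (G x)| <=
  L2norm (@euclid R d \o F) * L2norm (@euclid R d \o G).
Proof.
move=> LF LG; rewrite !L2norm_euclid//.
apply: Rintegral_cauchy_schwarz; [exact: integrable_dot..|].
apply: nearW => x t s; have := dot_ge0 (t *: F x + s *: G x).
rewrite dotDl !dotDr !dotZl !dotZr (dotC (G x)) => /le_trans; apply.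
by rewrite le_eqVlt; apply/orP; left; apply/eqP; ring.
Qed.

Lemma energy_cauchy_schwarz A F G : (forall i j, ae_bounded mu (fun x => A x i j)) ->
  symmetric_on_cube A ->
  (forall x, cube x -> forall z : 'cV[R]_d, 0 <= dot (A x *m z) z) ->
  L2vec F -> L2vec G -> `|energy A F G| <= energy_norm A F * energy_norm A G.
Proof.
move=> bA sA pA LF LG; apply: Rintegral_cauchy_schwarz;
  [by apply: integrable_dot => //; exact: L2vec_mulmx..|].
apply: cube_ae => x cx t s; have := pA x cx (t *: F x + s *: G x).
rewrite mulmxDr -!scalemxAr dotDl !dotDr !dotZl !dotZr.
(* Symmetry of [A] merges the two cross terms into 2 t s AF . G. *)
rewrite (dot_mulmx _ (G x) (F x)) sA// (dotC (G x)) => /le_trans; apply.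
by rewrite le_eqVlt; apply/orP; left; apply/eqP; ring.
Qed.

End cube_measure_theory.

(** * Measurability of the inverse of a matrix function *)

Section measurable_inverse.
Context d (T : measurableType d) (R : realType).

Lemma measurable_inv (f : T -> R) : measurable_fun [set: T] f ->
  measurable_fun [set: T] (fun x => (f x)^-1).
Proof.
move=> mf; rewrite (_ : (fun _ => _) = fun x => f x * (f x ^+ 2) `^ (- 1)).
  apply: measurable_funM => //.
  apply: (measurableT_comp (measurable_powR (- 1))).
  exact: measurable_funX.
apply/funext => x; rewrite powR_inv1 ?sqr_ge0//.
have [->|fx0] := eqVneq (f x) 0; first by rewrite invr0 mul0r.
by field.
Qed.

Lemma measurable_determinant n (A : T -> 'M[R]_n) :
  (forall i j, measurable_fun [set: T] (fun x => A x i j)) ->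
  measurable_fun [set: T] (fun x => \det (A x)).
Proof.
move=> mA; apply: measurable_sum => s.
apply: measurable_funM; first exact: measurable_cst.
by apply: measurable_prod => i _; exact: mA.
Qed.

Lemma measurable_invmx n (A : T -> 'M[R]_n) :
  (forall i j, measurable_fun [set: T] (fun x => A x i j)) ->
  forall i j, measurable_fun [set: T] (fun x => invmx (A x) i j).
Proof.
move=> mA i j; have mdet := measurable_determinant mA.
(* Cramer's rule, with the convention that [invmx] returns a singular matrix unchanged. *)
rewrite (_ : (fun _ => _) = fun x => if \det (A x) == 0 then A x i j
    else (\det (A x))^-1 * cofactor (A x) j i).
  apply: measurable_fun_ifT => //.
  - by apply: measurable_fun_eqr => //; exact: measurable_cst.
  - apply: measurable_funM; first exact: measurable_inv.
    apply: measurable_funM => //; apply: measurable_determinant => k l.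
    by under eq_fun do rewrite !mxE; exact: mA.
apply/funext => x; rewrite /invmx unitmxE unitfE.
by case: eqP => //= _; rewrite !mxE.
Qed.

End measurable_inverse.

(** * Open sets and continuous functions are measurable on R^d *)

Section borel_cV.
Variables (R : realType) (d : nat).

Let rational_box (p : 'cV[rat]_d * nat) : set 'cV[R]_d :=
  [set x | forall i, `|x i ord0 - ratr (p.1 i ord0)| < p.2.+1%:R^-1].

Let measurable_rational_box p : measurable (rational_box p).
Proof.
rewrite (_ : rational_box p = \bigcap_(i in [set: 'I_d]) (Defs.coord i @^-1`
    [set t | `|t - ratr (p.1 i ord0)| < p.2.+1%:R^-1])); last first.
  by apply/seteqP; split=> [x /= bx i _|x /= bx i]; [exact: bx|exact: bx i I].
apply: fin_bigcap_measurable => // i _; rewrite -[X in measurable X]setTI.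
apply: measurable_coord => //.
rewrite (_ : mkset _ = ball (ratr (p.1 i ord0) : R) p.2.+1%:R^-1).
  exact: measurable_ball.
by apply/seteqP; split=> t /=; rewrite /ball/= distrC.
Qed.

Let dist_lt (a b q r e : R) :
  `|a - q| < r -> `|b - q| < r -> r < e / 2 -> `|a - b| < e.
Proof.
rewrite !ltr_norml => /andP[? ?] /andP[? ?] ?.
by apply/andP; split; lra.
Qed.

(** The sigma-algebra is generated by the coordinates, while open sets come from the norm topology.
    Second countability links them: [U] is the union of the countably many rational boxes that it
    contains. *)
Lemma open_measurable_cV (U : set 'cV[R]_d) : open U -> measurable U.
Proof.
move=> oU; rewrite (_ : U = \bigcup_(p : 'cV[rat]_d * nat)
    (if `[< rational_box p `<=` U >] then rational_box p else set0)).
  apply: countable_bigcupT_measurable => // p.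
  by case: ifPn => // _; exact: measurable_rational_box.
apply/seteqP; split=> [x Ux|x [p _]]; last by case: asboolP => // /[apply].
have /nbhs_ballP[e /= e0 eU] := open_nbhs_nbhs (conj oU Ux).
(* Two points of a box of this radius are less than [e] apart, so a box containing [x] stays in the
   ball around [x]. *)
have [k ke] : exists k : nat, k.+1%:R^-1 < e / 2.
  have [k] := @ltr_add_invr R 0 (e / 2) (divr_gt0 e0 (ltr0n _ 2)).
  by rewrite add0r; exists k.
have k0 : 0 < k.+1%:R^-1 :> R by rewrite invr_gt0.
have q_ex (i : 'I_d) : {q : rat | `|x i ord0 - ratr q| < k.+1%:R^-1}.
  apply: cid; have [|q] := @rat_in_itvoo R (x i ord0 - k.+1%:R^-1) (x i ord0).
    by rewrite ltrBlDr ltrDl.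
  rewrite in_itv/= => /andP[q1 q2]; exists q.
  by rewrite ger0_norm ?subr_ge0 ?ltW// ltrBlDr addrC -ltrBlDr.
pose p : 'cV[rat]_d * nat := (\col_i sval (q_ex i), k).
have px : rational_box p x by move=> i; rewrite /= mxE; exact: svalP (q_ex i).
exists p => //; case: asboolP => // -[]; move=> y py; apply: eU; split=> // i j.
have -> : j = ord0 by rewrite [j]ord1; exact: val_inj.
rewrite -ball_normE; exact: (dist_lt (px i) (py i) ke).
Qed.

Lemma measurable_continuous_cV (g : 'cV[R]_d -> R) :
  continuous g -> measurable_fun [set: 'cV[R]_d] g.
Proof.
move=> /continuousP cg; apply: (measurability _ (RGenOInfty.measurableE R)).
move=> _ [_ [a ->] <-]; rewrite setTI; apply: open_measurable_cV.
exact/cg/interval_open.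
Qed.

End borel_cV.

(** * Test functions and their partial derivatives *)

Section test_functions.
Variables (R : realType) (d : nat).
Implicit Types phi psi : 'cV[R]_d -> R.
Local Notation partials := (foldr (@partial R d)).

Lemma smooth_continuous phi s : smooth phi -> continuous (partials phi s).
Proof. by move=> sphi x; exact/differentiable_continuous/sphi. Qed.

(** The complement of the support is open, so there each iterated partial derivative is locally zero
    and can be differentiated as a constant. *)
Lemma partials_vanish phi s x :
  ~ closure [set x | phi x != 0] x -> partials phi s x = 0.
Proof.
elim: s x => [|i s IHs] x nx /=.
  by apply: contrapT => /eqP phix; apply: nx; exact: subset_closure.
rewrite /partial -(@derive_cst R _ _ (0 : R) x (delta_mx i ord0)).
apply: near_eq_derive.
have : nbhs x (~` closure [set x | phi x != 0]).
  by apply: open_nbhs_nbhs; split=> //; exact/closed_openC/closed_closure.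
by apply: filterS => y /IHs.
Qed.

(** Continuity bounds the derivative on the compact support, and it vanishes elsewhere. The list [s]
    covers the function itself and its gradient at once. *)
Lemma L2_partials phi s : test_function phi -> L2 (partials phi s).
Proof.
move=> [sphi Kphi _].
have cs := smooth_continuous (s := s) sphi.
have [M M0 MK] : exists2 M : R, 0 < M &
    forall x, closure [set x | phi x != 0] x -> `|partials phi s x| <= M.
  have := @continuous_compact _ _ (partials phi s) _ (continuous_subspaceT cs) Kphi.
  move=> /compact_bounded /pinfty_ex_gt0[M M0 MK]; exists M => // x Kx.
  by apply: MK; exists x.
apply: (@L2_cube_bounded _ _ _ M).
  exact: measurable_continuous_cV.
move=> x _; have [/MK//|nKx] := pselect (closure [set x | phi x != 0] x).
by rewrite partials_vanish// normr0 ltW.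
Qed.

Lemma L2_test phi : test_function phi -> L2 phi.
Proof. exact: (@L2_partials phi [::]). Qed.

Lemma L2vec_gradient phi : test_function phi -> L2vec (gradient phi).
Proof.
move=> tphi i; rewrite /L2 (_ : (fun _ => _) = partial i phi).
  exact: (@L2_partials phi [:: i]).
by apply/funext => x; rewrite mxE.
Qed.

Lemma partialsB phi psi s : smooth phi -> smooth psi ->
  partials (phi \- psi) s = partials phi s \- partials psi s.
Proof.
move=> sphi spsi; elim: s => [//|i s IHs] /=; rewrite IHs.
by apply/funext => x; apply: deriveB; exact: diff_derivable.
Qed.

Lemma test_functionB phi psi :
  test_function phi -> test_function psi -> test_function (phi \- psi).
Proof.
move=> [sphi Kphi phic] [spsi Kpsi psic].
have sub : closure [set x | (phi \- psi) x != 0] `<=`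
    closure [set x | phi x != 0] `|` closure [set x | psi x != 0].
  rewrite -closureU; apply: closure_subset => x /=.
  have [->|] := eqVneq (phi x) 0; last by left.
  by rewrite sub0r oppr_eq0; right.
split.
- by move=> s x; rewrite partialsB//; exact: differentiableB.
- apply: subclosed_compact sub; first exact: closed_closure.
  exact: compactU.
- by move=> x /sub[/phic|/psic].
Qed.

Lemma gradientB phi psi x : test_function phi -> test_function psi ->
  gradient (phi \- psi) x = gradient phi x - gradient psi x.
Proof.
move=> [sphi _ _] [spsi _ _]; apply/matrixP => i j; rewrite !mxE.
by have /(congr1 (@^~ x)) := @partialsB phi psi [:: i] sphi spsi.
Qed.

End test_functions.

(** * The space H^1_0 and integration by parts against H(div) *)

Section sobolev.
Variables (R : realType) (d : nat).
Local Notation mu := (@cube_measure R d).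
Implicit Types (phi w z : 'cV[R]_d -> R) (F Dw Dz : 'cV[R]_d -> 'cV[R]_d).

Lemma eL2norm_le (f g : 'cV[R]_d -> R) : L2 f -> L2 g ->
  (forall x, `|f x| <= `|g x|) -> (eL2norm f <= eL2norm g)%E.
Proof.
move=> Lf Lg fg; rewrite /eL2norm !Lnorm2_sqrt// lee_fin ler_wsqrtr//.
apply: le_Rintegral => //; [exact: Lfun2_integrable_sqr..|] => x _.
rewrite -[leLHS]ger0_norm ?sqr_ge0// -[leRHS]ger0_norm ?sqr_ge0// !normrX.
by rewrite lerXn2r ?nnegrE.
Qed.

Lemma eL2normD (f g : 'cV[R]_d -> R) : L2 f -> L2 g ->
  (eL2norm (f \+ g)%R <= eL2norm f + eL2norm g)%E.
Proof.
move=> Lf Lg; apply: eminkowski; rewrite ?lee_fin ?ler1n//;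
  [exact: measurable_Lfun Lf|exact: measurable_Lfun Lg].
Qed.

Lemma eL2norm0 : eL2norm (fun _ : 'cV[R]_d => 0 : R) = 0%E.
Proof.
rewrite -[RHS](@Lnorm0 _ _ _ mu 2%:E) ?eqe ?pnatr_eq0//.
Qed.

Lemma H10_L2vec w Dw : H10 w Dw -> L2vec Dw. Proof. by case. Qed.

(** The approximating sequence is constant. This allows the equation of [u] to be tested with C_c^oo
    functions, as the weak divergence of the optimal flux requires. *)
Lemma H10_test phi : test_function phi -> H10 phi (gradient phi).
Proof.
move=> tphi; split; [exact: L2_test|exact: L2vec_gradient|].
exists (fun=> phi); split=> //.
- rewrite (_ : phi \- phi = fun=> 0); last by apply/funext => x; exact: subrr.
  by rewrite eL2norm0; exact: cvg_cst.
- rewrite (_ : (fun x => euclid (gradient phi x - gradient phi x)) = fun=> 0).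
  by rewrite eL2norm0; exact: cvg_cst.
  apply/funext => x; rewrite subrr /euclid /dot big1 ?sqrtr0// => i _.
  by rewrite mxE mul0r.
Qed.

(** This makes the error [u - ut] an admissible test function. Differences of approximants converge
    by Minkowski's inequality and squeezing. *)
Lemma H10B w Dw z Dz : H10 w Dw -> H10 z Dz ->
  H10 (w \- z) (fun x => Dw x - Dz x).
Proof.
move=> [Lw LDw [phi [tphi phiw gphiw]]] [Lz LDz [psi [tpsi psiz gpsiz]]].
split; [exact: (Lfun2B Lw Lz)|exact: L2vecB|].
exists (fun n => phi n \- psi n).
have def0 : ((0 : \bar R) +? 0)%E by [].
split.
- by move=> n; exact: test_functionB.
- have := cvgeD def0 phiw psiz; rewrite adde0 => /(_ _) cv.
  refine (squeeze_cvge (f := cst 0%E) _ (cvg_cst _) cv).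
  apply: nearW => n; rewrite Lnorm_ge0 /=.
  have L1 : L2 (phi n \- w) := Lfun2B (L2_test (tphi n)) Lw.
  have L2' : L2 (psi n \- z) := Lfun2B (L2_test (tpsi n)) Lz.
  have Lm : L2 (z \- psi n) := Lfun2B Lz (L2_test (tpsi n)).
  (* Minkowski is applied to (phi n - w) + (z - psi n), so the sign of the second term is
     flipped. *)
  have -> : eL2norm (psi n \- z) = eL2norm (z \- psi n).
    by apply/eqP; rewrite eq_le !eL2norm_le// => x /=; rewrite distrC.
  apply: le_trans (eL2normD L1 Lm).
  rewrite le_eqVlt; apply/orP; left; apply/eqP; congr eL2norm.
  by apply/funext => x /=; ring.
- have := cvgeD def0 gphiw gpsiz; rewrite adde0 => /(_ _) cv.
  refine (squeeze_cvge (f := cst 0%E) _ (cvg_cst _) cv).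
  apply: nearW => n; rewrite Lnorm_ge0 /=.
  have L1 := L2vecB (L2vec_gradient (tphi n)) LDw.
  have L2' := L2vecB (L2vec_gradient (tpsi n)) LDz.
  have L3 := L2vecB (L2vec_gradient (test_functionB (tphi n) (tpsi n)))
    (L2vecB LDw LDz).
  apply: le_trans (eL2normD (L2_euclid L1) (L2_euclid L2')).
  apply: eL2norm_le; first exact: (L2_euclid L3).
    exact: (Lfun2D (L2_euclid L1) (L2_euclid L2')).
  move=> x /=; rewrite !ger0_norm ?addr_ge0 ?euclid_ge0//.
  apply: le_trans (euclidB_le _ _); rewrite gradientB//.
  rewrite le_eqVlt; apply/orP; left; apply/eqP; congr euclid.
  by rewrite !opprB addrACA [RHS]addrACA (addrC (- Dw x)).
Qed.

Lemma Hdiv_H10 y divy w Dw : Hdiv y divy -> H10 w Dw ->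
  \int[mu]_x dot (y x) (Dw x) = - \int[mu]_x (divy x * w x).
Proof.
move=> [Ly Ldivy ydiv] [Lw LDw [phi [tphi phiw gphiw]]].
apply/eqP; rewrite -subr_eq0 opprK -normr_le0.
set a := (X in `|X| <= _).
(* The defect [a] of the identity for [w] does not depend on [n]; Cauchy-Schwarz bounds it by [b n],
   which tends to 0. *)
pose b n := L2norm (@euclid R d \o y) *
    L2norm (fun x => euclid (gradient (phi n) x - Dw x)) +
  L2norm divy * L2norm (phi n \- w).
have b0 : b n @[n --> \oo] --> 0.
  rewrite -[X in _ --> X]addr0 -[X in _ --> X + _](mulr0 (L2norm (@euclid R d \o y))).
  rewrite -[X in _ --> _ + X](mulr0 (L2norm divy)).
  by apply: cvgD; apply: cvgM;
    [exact: cvg_cst|exact: fine_cvg gphiw|exact: cvg_cst|exact: fine_cvg phiw].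
apply: (@cvgr_to_ge _ _ _ _ _ _ _ b0); apply: nearW => n.
have Lg := L2vec_gradient (tphi n); have Lp := L2_test (tphi n).
have Lgw := L2vecB Lg LDw; have Lpw : L2 (phi n \- w) := Lfun2B Lp Lw.
(* The identity is exact for [phi n], so only the approximation errors remain. *)
rewrite (_ : a = - (\int[mu]_x dot (y x) (gradient (phi n) x - Dw x) +
    \int[mu]_x (divy x * (phi n x - w x)))).
  rewrite normrN (le_trans (ler_normD _ _))// lerD//.
    exact: (dot_L2_cauchy_schwarz Ly Lgw).
  exact: (L2_cauchy_schwarz Ldivy Lpw).
have -> : \int[mu]_x dot (y x) (gradient (phi n) x - Dw x) =
    \int[mu]_x dot (y x) (gradient (phi n) x) - \int[mu]_x dot (y x) (Dw x).
  rewrite -RintegralB//; [|exact: integrable_dot..].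
  by apply: eq_Rintegral => x _; rewrite dotBr.
have -> : \int[mu]_x (divy x * (phi n x - w x)) =
    \int[mu]_x (divy x * phi n x) - \int[mu]_x (divy x * w x).
  rewrite -RintegralB//; [|exact: (Lfun2M_integrable Ldivy)..].
  by apply: eq_Rintegral => x _; rewrite mulrBr.
by rewrite ydiv// /a; ring.
Qed.

End sobolev.

(** * The energy form of an elliptic symmetric matrix function *)

Section elliptic_energy.
Variables (R : realType) (d : nat).
Local Notation mu := (@cube_measure R d).
Implicit Types (F G : 'cV[R]_d -> 'cV[R]_d).

Lemma Rintegral_dotB F G (H : 'cV[R]_d -> 'cV[R]_d) :
  L2vec F -> L2vec G -> L2vec H ->
  \int[mu]_x dot (F x - G x) (H x) =
  \int[mu]_x dot (F x) (H x) - \int[mu]_x dot (G x) (H x).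
Proof.
move=> LF LG LH; rewrite -RintegralB//; [|exact: integrable_dot..].
by apply: eq_Rintegral => x _; rewrite dotBl.
Qed.

Lemma Rintegral_dotZ (k : R) F G : L2vec F -> L2vec G ->
  \int[mu]_x dot (k *: F x) (G x) = k * \int[mu]_x dot (F x) (G x).
Proof.
move=> LF LG; rewrite -RintegralZl//; last exact: integrable_dot.
by apply: eq_Rintegral => x _; rewrite dotZl.
Qed.

Variables (A : 'cV[R]_d -> 'M[R]_d) (l L : R).
Hypotheses (l0 : 0 < l) (Asym : symmetric_on_cube A) (Aell : elliptic A l L).
Hypothesis mA : forall i j, measurable_fun [set: 'cV[R]_d] (fun x => A x i j).

Lemma elliptic_ge0 x : cube x -> forall z : 'cV[R]_d, 0 <= dot (A x *m z) z.
Proof.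
move=> cx z; have /andP[+ _] := Aell cx z; apply: le_trans.
by rewrite mulr_ge0 ?dot_ge0 ?ltW.
Qed.

(** For a symmetric matrix the bounds on the quadratic form control every entry, so ellipticity and
    measurability put [A] in L^oo. *)
Lemma elliptic_ae_bounded i j : ae_bounded mu (fun x => A x i j).
Proof.
apply: (@cube_bounded_ae_bounded _ _ _ L) => // x cx.
apply: normr_entry_le; first exact: Asym.
by move=> z; rewrite elliptic_ge0//; have /andP[] := Aell cx z.
Qed.

Lemma elliptic_invmx_ae_bounded i j : ae_bounded mu (fun x => invmx (A x) i j).
Proof.
apply: (@cube_bounded_ae_bounded _ _ _ l^-1); first exact: measurable_invmx.
move=> x cx; apply: normr_entry_le; first by rewrite trmx_inv Asym.
exact: (coercive_invmx l0 (Asym cx) (Aell cx)).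
Qed.

Lemma L2vec_elliptic F : L2vec F -> L2vec (fun x => A x *m F x).
Proof. by apply: L2vec_mulmx; exact: elliptic_ae_bounded. Qed.

Lemma L2vec_elliptic_inv F : L2vec F -> L2vec (fun x => invmx (A x) *m F x).
Proof. by apply: L2vec_mulmx; exact: elliptic_invmx_ae_bounded. Qed.

Lemma energyBl F G (H : 'cV[R]_d -> 'cV[R]_d) :
  L2vec F -> L2vec G -> L2vec H ->
  energy A (fun x => F x - G x) H = energy A F H - energy A G H.
Proof.
move=> LF LG LH; rewrite /energy -Rintegral_dotB//; [|exact: L2vec_elliptic..].
by apply: eq_Rintegral => x _; rewrite mulmxBr.
Qed.

Lemma sqr_energy_norm F : L2vec F -> energy_norm A F ^+ 2 = energy A F F.
Proof.
move=> LF; rewrite sqr_sqrtr//.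
have -> : (0 : R) = \int[mu]_x cst 0 x by rewrite Rintegral_cst// mul0r.
apply: ae_le_Rintegral; first exact: integrable0.
  by apply: integrable_dot => //; exact: L2vec_elliptic.
by apply: cube_ae => x cx; exact: elliptic_ge0.
Qed.

(** The integrated form of l |F|^2 <= AF . F; taking roots is what makes [Num.sqrt l] the natural
    weight of the residual. *)
Lemma L2norm_euclid_le_energy F : L2vec F ->
  L2norm (@euclid R d \o F) <= energy_norm A F / Num.sqrt l.
Proof.
move=> LF; rewrite ler_pdivlMr ?sqrtr_gt0// L2norm_euclid//.
rewrite mulrC -sqrtrM ?(ltW l0)// /energy_norm /energy.
apply: ler_wsqrtr; rewrite -RintegralZl//; last exact: integrable_dot.
apply: ae_le_Rintegral.
- exact: (integrableZl measurableT l (integrable_dot LF LF)).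
- by apply: integrable_dot => //; exact: L2vec_elliptic.
- by apply: cube_ae => x cx; have /andP[] := Aell cx (F x).
Qed.

(* Completing the square in the integrand of the flux term. *)
Lemma majorant_fluxE F G : L2vec F -> L2vec G ->
  majorant_flux A F G = energy_norm A (fun x => invmx (A x) *m G x - F x).
Proof.
move=> LF LG; have LAF := L2vec_elliptic LF; have LIG := L2vec_elliptic_inv LG.
have LIGF := L2vecB LIG LF; have LA := L2vec_elliptic LIGF.
congr Num.sqrt; apply: ae_eq_Rintegral.
- apply: measurable_funB; first by apply: measurable_funD; exact: measurable_dot.
  by apply: measurable_funM; [exact: measurable_cst|exact: measurable_dot].
- exact: measurable_dot.
apply: cube_ae => x cx; have uA := coercive_unitmx l0 (Asym cx) (Aell cx).
(* By symmetry AF . A^-1 G = F . G, so the cross terms add up to -2 F . G. *)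
rewrite mulmxBr mulKVmx// dotBl !dotBr (dot_mulmx _ (F x) (invmx _ *m _)).
rewrite Asym// mulKVmx// (dotC (G x) (F x)) (dotC (G x) (invmx _ *m _)).
by ring.
Qed.

(** On the cube [A] cancels its inverse, leaving an integrand linear in the flux to which the
    divergence identity applies. *)
Lemma energy_invmxE F G (H : 'cV[R]_d -> 'cV[R]_d) :
  L2vec F -> L2vec G -> L2vec H ->
  energy A (fun x => invmx (A x) *m G x - F x) H =
  \int[mu]_x dot (G x - A x *m F x) (H x).
Proof.
move=> LF LG LH; have LAF := L2vec_elliptic LF.
have LIG := L2vec_elliptic_inv LG; have LIGF := L2vecB LIG LF.
have LA := L2vec_elliptic LIGF.
apply: ae_eq_Rintegral; [exact: measurable_dot| |].
  by apply: measurable_dot => //; exact: L2vecB.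
apply: cube_ae => x cx; have uA := coercive_unitmx l0 (Asym cx) (Aell cx).
by rewrite mulmxBr mulKVmx.
Qed.

End elliptic_energy.

(** * The error identity, the upper bound and the optimal flux *)

Section error_control.
Variables (R : realType) (d : nat).
Local Notation mu := (@cube_measure R d).
Variables (f : 'cV[R]_d -> R) (Aeps A0 : 'cV[R]_d -> 'M[R]_d) (l L rho : R).
Hypotheses (hf : L2 f)
  (hAeps : forall i j, (fun x => Aeps x i j) \in Lfun mu +oo%E)
  (mA0 : forall i j, measurable_fun [set: 'cV[R]_d] (fun x => A0 x i j))
  (A0sym : symmetric_on_cube A0) (l0 : 0 < l) (A0ell : elliptic A0 l L).
Variables (u v ut : 'cV[R]_d -> R) (Du Dv Dut : 'cV[R]_d -> 'cV[R]_d).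
Hypotheses (hv : H10 v Dv) (hu : H10 u Du) (hut : H10 ut Dut)
  (hu_eq : forall w Dw, H10 w Dw ->
    energy A0 Du Dw = energy A0 Dv Dw
      - rho * \int[mu]_x (dot (Aeps x *m Dv x) (Dw x) - f x * w x)).
Local Notation err := (energy_norm A0 (fun x => Du x - Dut x)).

Let LDu := H10_L2vec hu.
Let LDv := H10_L2vec hv.
Let LDut := H10_L2vec hut.
Let L2A0 F : L2vec F -> L2vec (fun x => A0 x *m F x).
Proof. exact: (L2vec_elliptic l0 A0sym A0ell mA0). Qed.

Let LAeps : L2vec (fun x => Aeps x *m Dv x).
Proof. by apply: L2vec_mulmx => // i j; exact: Lfuny_ae_bounded. Qed.

(** The equation of [u], regrouped to say that A0 D(u - v) + rho Aeps Dv has weak divergence -rho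
    f. *)
Lemma energy_solution w Dw : H10 w Dw ->
  energy A0 (fun x => Du x - Dv x) Dw +
    rho * \int[mu]_x dot (Aeps x *m Dv x) (Dw x) =
  rho * \int[mu]_x (f x * w x).
Proof.
move=> hw; have [Lw LDw _] := hw.
rewrite (energyBl l0 A0sym A0ell mA0)// (hu_eq hw).
rewrite RintegralB//; [|exact: integrable_dot|exact: Lfun2M_integrable].
by ring.
Qed.

(** Write D(u - ut) = D(u - v) - D(ut - v). The terms in [Aeps] cancel between the equation of [u]
    and the flux [tau], and the remaining volume terms form the residual. *)
Lemma energy_residual y divy w Dw : Hdiv y divy -> H10 w Dw ->
  energy A0 (fun x => Du x - Dut x) Dw =
  energy A0 (fun x => invmx (A0 x) *m (y x - rho *: (Aeps x *m Dv x))
                      - (Dut x - Dv x)) Dw +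
  \int[mu]_x ((divy x + rho * f x) * w x).
Proof.
move=> hy hw; have [Lw LDw _] := hw; have [Ly Ldivy _] := hy.
have LrA := L2vecZ rho LAeps; have Leta := L2vecB LDut LDv.
have Ltau := L2vecB Ly LrA.
rewrite (energy_invmxE l0 A0sym A0ell mA0)// Rintegral_dotB//; last exact: L2A0.
rewrite Rintegral_dotB// Rintegral_dotZ// (Hdiv_H10 hy hw).
rewrite [X in _ - _ - X](energyBl l0 A0sym A0ell mA0 LDut LDv LDw).
have -> : \int[mu]_x ((divy x + rho * f x) * w x) =
    \int[mu]_x (divy x * w x) + rho * \int[mu]_x (f x * w x).
  have ifw := Lfun2M_integrable hf Lw.
  rewrite -RintegralZl// -RintegralD//; last 2 first.
  - exact: (Lfun2M_integrable Ldivy Lw).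
  - exact: (integrableZl measurableT rho ifw).
  by apply: eq_Rintegral => x _; rewrite mulrDl mulrA.
rewrite -(energy_solution hw) !(energyBl l0 A0sym A0ell mA0)//.
by ring.
Qed.

(** The weight [CF / kappa] decreases in [kappa], so the case [kappa = Num.sqrt l] is the sharpest
    and implies the others. *)
Lemma error_le_majorant (CF kappa : R) y divy : friedrichs d CF ->
  0 < kappa <= Num.sqrt l -> Hdiv y divy ->
  err <= majorant A0 Aeps rho f CF kappa Dut Dv y divy.
Proof.
move=> [CF0 hCF] /andP[k0 kl] hy; have [Ly Ldivy _] := hy.
have hw := H10B hu hut; have [Lw LDw _] := hw.
set tau := fun x => y x - rho *: (Aeps x *m Dv x).
have Ltau : L2vec tau := L2vecB Ly (L2vecZ rho LAeps).
have Leta := L2vecB LDut LDv.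
have LP := L2vecB (L2vec_elliptic_inv l0 A0sym A0ell mA0 Ltau) Leta.
have Lres : L2 (fun x => divy x + rho * f x) := Lfun2D Ldivy (Lfun2Z rho hf).
rewrite /majorant (majorant_fluxE l0 A0sym A0ell mA0 Leta Ltau).
set P := (X in energy_norm A0 X + _) in LP *.
set r := L2norm _.
(* A vanishing error is treated apart, since otherwise the inequality is multiplied by [err] and
   cancelled afterwards. *)
have [err0|err0] := eqVneq err 0.
  rewrite err0 addr_ge0 ?sqrtr_ge0// mulr_ge0 ?divr_ge0 ?(ltW k0)//.
  by rewrite /r /L2norm fine_ge0// Lnorm_ge0.
have err_gt0 : 0 < err by rewrite lt0r err0 sqrtr_ge0.
have r0 : 0 <= r by rewrite /r /L2norm fine_ge0// Lnorm_ge0.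
rewrite -(ler_pM2r err_gt0) -expr2 (sqr_energy_norm l0 A0sym A0ell mA0 LDw).
rewrite (energy_residual hy hw) mulrDl lerD//.
  apply: le_trans (ler_norm _) _; apply: energy_cauchy_schwarz => //.
  - exact: (elliptic_ae_bounded l0 A0sym A0ell mA0).
  - exact: (elliptic_ge0 l0 A0ell).
apply: le_trans (ler_norm _) _; apply: le_trans (L2_cauchy_schwarz Lres Lw) _.
(* With W = D(u - ut), the chain is |w| <= CF |W| <= CF err / sqrt l <= CF err / kappa. *)
rewrite -/r mulrAC (mulrC r) ler_wpM2r//.
apply: le_trans (hCF _ _ hw) _.
rewrite -mulrA ler_wpM2l// (le_trans (L2norm_euclid_le_energy l0 A0sym A0ell mA0 LDw))//.
rewrite mulrC ler_wpM2r ?sqrtr_ge0// lef_pV2 ?posrE// sqrtr_gt0//.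
Qed.

Let flux x := A0 x *m (Du x - Dv x) + rho *: (Aeps x *m Dv x).

Lemma Hdiv_optimal_flux : Hdiv flux (fun x => - (rho * f x)).
Proof.
have LA := L2A0 (L2vecB LDu LDv); have LrA := L2vecZ rho LAeps.
split; first exact: L2vecD.
  rewrite /L2 (_ : (fun _ => _) = fun x => - rho * f x).
    exact: Lfun2Z.
  by apply/funext => x; rewrite mulNr.
move=> phi tphi; have Lg := L2vec_gradient tphi.
have -> : \int[mu]_x dot (flux x) (gradient phi x) =
    energy A0 (fun x => Du x - Dv x) (gradient phi) +
    rho * \int[mu]_x dot (Aeps x *m Dv x) (gradient phi x).
  rewrite -Rintegral_dotZ// -RintegralD//; [|exact: integrable_dot..].
  by apply: eq_Rintegral => x _; rewrite dotDl.
rewrite (energy_solution (H10_test tphi)).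
have ifp := Lfun2M_integrable hf (L2_test tphi).
rewrite -[in RHS]mulN1r -!RintegralZl//; last first.
  rewrite (_ : _ \o _ = EFin \o (fun x => - rho * (f x * phi x))).
    exact: (integrableZl measurableT (- rho) ifp).
  by apply/funext => x /=; congr _%:E; ring.
by apply: eq_Rintegral => x _; ring.
Qed.

(** Here A0^-1 tau = D(u - v) on the cube, and subtracting D(ut - v) leaves D(u - ut). *)
Lemma majorant_optimal_flux :
  majorant_flux A0 (fun x => Dut x - Dv x) (fun x => A0 x *m (Du x - Dv x)) = err.
Proof.
have Leta := L2vecB LDut LDv; have Luv := L2vecB LDu LDv.
have LA := L2A0 Luv; have LW := L2vecB LDu LDut.
have LP := L2vecB (L2vec_elliptic_inv l0 A0sym A0ell mA0 LA) Leta.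
rewrite (majorant_fluxE l0 A0sym A0ell mA0)//; congr Num.sqrt.
apply: ae_eq_Rintegral; [by apply: measurable_dot => //; exact: L2A0..|].
apply: cube_ae => x cx; have uA := coercive_unitmx l0 (A0sym cx) (A0ell cx).
by rewrite mulKmx// (_ : Du x - Dv x - _ = Du x - Dut x)// opprB addrA subrK.
Qed.

End error_control.

Theorem mainTheorem3 (R : realType) (d : nat) (hd : (0 < d <= 3)%N)
  (f : 'cV[R]_d -> R) (hf : L2 f)
  (Aeps A0 : 'cV[R]_d -> 'M[R]_d)
  (hAeps : forall i j, (fun x => Aeps x i j) \in Lfun (@cube_measure R d) +oo%E)
  (hAeps_sym : symmetric_on_cube Aeps)
  (hA0 : forall i j, measurable_fun [set: 'cV[R]_d] (fun x => A0 x i j))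
  (hA0_sym : symmetric_on_cube A0)
  (lamepsm lamepsp lam0m lam0p : R)
  (hlamepsm : 0 < lamepsm) (hlamepsp : 0 < lamepsp)
  (hlam0m : 0 < lam0m) (hlam0p : 0 < lam0p)
  (hAeps_ell : elliptic Aeps lamepsm lamepsp)
  (hA0_ell : elliptic A0 lam0m lam0p)
  (CF : R) (hCF : friedrichs d CF)
  (rho : R) (hrho : 0 < rho)
  (v : 'cV[R]_d -> R) (Dv : 'cV[R]_d -> 'cV[R]_d) (hv : H10 v Dv)
  (u : 'cV[R]_d -> R) (Du : 'cV[R]_d -> 'cV[R]_d) (hu : H10 u Du)
  (hu_eq : forall w Dw, H10 w Dw ->
    energy A0 Du Dw = energy A0 Dv Dw
      - rho * \int[@cube_measure R d]_x (dot (Aeps x *m Dv x) (Dw x) - f x * w x))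
  (ut : 'cV[R]_d -> R) (Dut : 'cV[R]_d -> 'cV[R]_d) (hut : H10 ut Dut) :
  let err := energy_norm A0 (fun x => Du x - Dut x) in
  (forall kappa : R,
     (kappa = lam0m /\ lam0m <= 1) \/ kappa = Num.sqrt lam0m ->
     (forall y divy, Hdiv y divy ->
        err <= majorant A0 Aeps rho f CF kappa Dut Dv y divy) /\
     inf [set M | exists y divy, Hdiv y divy /\
            M = majorant A0 Aeps rho f CF kappa Dut Dv y divy] = err) /\
  (let y := fun x => A0 x *m (Du x - Dv x) + rho *: (Aeps x *m Dv x) in
   let tau := fun x => y x - rho *: (Aeps x *m Dv x) in
   [/\ tau = (fun x => A0 x *m (Du x - Dv x)),
       Hdiv y (fun x => - (rho * f x)) &
       majorant_flux A0 (fun x => Dut x - Dv x) tau = err]).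

Proof.
have tauE : (fun x => A0 x *m (Du x - Dv x) + rho *: (Aeps x *m Dv x)
    - rho *: (Aeps x *m Dv x)) = (fun x => A0 x *m (Du x - Dv x)).
  by apply/funext => x; rewrite addrK.
have hy := Hdiv_optimal_flux hf hAeps hA0 hA0_sym hlam0m hA0_ell hv hu hu_eq.
have hflux := majorant_optimal_flux hA0 hA0_sym hlam0m hA0_ell hv hu hut.
move=> err; split=> [kappa hkappa|]; last by move=> y tau; rewrite /tau /y tauE.
(* Both admissible choices of [kappa] lie in this range: if lam0m <= 1, then lam0m is at most its
   square root. *)
have hk : 0 < kappa <= Num.sqrt lam0m.
  case: hkappa => [[-> lam1]|->]; last by rewrite sqrtr_gt0 hlam0m lexx.
  rewrite hlam0m -[leLHS]sqr_sqrtr ?(ltW hlam0m)// expr2 ler_piMr ?sqrtr_ge0//.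
  by rewrite -[leRHS]sqrtr1 ler_wsqrtr.
have le_maj := fun y divy => error_le_majorant hf hAeps hA0 hA0_sym hlam0m
  hA0_ell hv hu hut hu_eq (y := y) (divy := divy) hCF hk.
split=> //; set S := [set M | _].
(* The optimal flux has zero residual, so the value [err] is attained; being also a lower bound of
   [S], it is the infimum. *)
have Serr : S err.
  exists (fun x => A0 x *m (Du x - Dv x) + rho *: (Aeps x *m Dv x)).
  exists (fun x => - (rho * f x)); split=> //.
  rewrite /majorant tauE hflux [L2norm _](_ : _ = 0) ?mulr0 ?addr0//.
  rewrite /L2norm (_ : (fun _ => _) = fun=> 0) ?eL2norm0//.
  by apply/funext => x; rewrite addNr.
have lbS : lbound S err by move=> M [y [divy [yM ->]]]; exact: le_maj.
apply/eqP; rewrite eq_le; apply/andP; split.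
  by apply: ge_inf => //; exists err.
by apply: lb_le_inf => //; exists err.
Qed.
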